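(* Let $n\ge 5$ and let $F\in\{P_4,\,2K_2,\,C_3\}$. If $G$ has the maximum $Q$-index among all connected outerplanar graphs of order $n$ that do not contain $F$ as a subgraph, then $G\cong K_{1,n-1}$.
   Context: For a graph $G$, $Q(G)=D(G)+A(G)$ is the signless Laplacian matrix and the $Q$-index $q(G)$ is its largest eigenvalue. $P_4$ is the path on 4 vertices, $2K_2$ two disjoint edges, $C_3$ the triangle, and $K_{1,n-1}$ the star. A graph is outerplanar if it has a planar embedding with all vertices on the boundary of the outer face. *)

(* Defs.v *)
From HB Require Import structures.
From mathcomp Require Import all_boot all_order all_algebra.
From mathcomp Require Import all_classical all_reals all_analysis.
Set Implicit Arguments. Unset Strict Implicit. Unset Printing Implicit Defensive.
Import Order.TTheory GRing.Theory Num.Theory numFieldNormedType.Exports.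
Local Open Scope classical_set_scope.
Local Open Scope ring_scope.

Definition simple_graph (n : nat) (G : rel 'I_n) : Prop :=
  symmetric G /\ irreflexive G.

Definition graph_connected (n : nat) (G : rel 'I_n) : Prop :=
  forall x y : 'I_n, connect G x y.

Definition contains_subgraph (k n : nat) (F : rel 'I_k) (G : rel 'I_n) : Prop :=
  exists f : 'I_k -> 'I_n, injective f /\ forall i j, F i j -> G (f i) (f j).

Definition P4_rel : rel 'I_4 :=
  fun i j => ((val i).+1 == val j) || ((val j).+1 == val i).
Definition twoK2_rel : rel 'I_4 :=
  fun i j => [|| (val i == 0%N) && (val j == 1%N), (val i == 1%N) && (val j == 0%N),
                 (val i == 2%N) && (val j == 3%N) | (val i == 3%N) && (val j == 2%N)].
Definition C3_rel : rel 'I_3 := fun i j => i != j.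

Inductive forbidden := FP4 | F2K2 | FC3.

Definition F_free (f : forbidden) (n : nat) (G : rel 'I_n) : Prop :=
  match f with
  | FP4 => ~ contains_subgraph P4_rel G
  | F2K2 => ~ contains_subgraph twoK2_rel G
  | FC3 => ~ contains_subgraph C3_rel G
  end.

Definition star_rel (n : nat) : rel 'I_n :=
  fun i j => (i != j) && ((val i == 0)%N || (val j == 0)%N).

Arguments star_rel n : clear implicits.

Definition isomorphic (n : nat) (G H : rel 'I_n) : Prop :=
  exists f : 'I_n -> 'I_n, bijective f /\ forall i j, G i j = H (f i) (f j).

Definition deg (n : nat) (G : rel 'I_n) (i : 'I_n) : nat := #|[set j | G i j]|.

Definition signless_laplacian (R : realType) (n : nat) (G : rel 'I_n) : 'M[R]_n :=
  \matrix_(i, j) ((if i == j then (deg G i)%:R else 0) + (G i j)%:R).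

Definition Qindex (R : realType) (n : nat) (G : rel 'I_n) : R :=
  sup [set r : R | eigenvalue (signless_laplacian R G) r].


Definition unit_seg (R : realType) : set R := [set t | 0 <= t <= 1].
Definition open_seg (R : realType) : set R := [set t | 0 < t < 1].


Arguments unit_seg R : clear implicits.
Arguments open_seg R : clear implicits.
Arguments signless_laplacian R [n] G.
Arguments Qindex R [n] G.

(* (u,v) with u < v is the canonical representative of the edge uv *)
Definition is_edge (n : nat) (G : rel 'I_n) (u v : 'I_n) : bool :=
  (val u < val v)%N && G u v.

Definition outerplanar_embedding (R : realType) (n : nat) (G : rel 'I_n)
    (pos : 'I_n -> R * R) (arc : 'I_n -> 'I_n -> R -> R * R) : Prop :=
  [/\ injective pos,
      forall u v, is_edge G u v ->
        [/\ {within (unit_seg R), continuous (arc u v)},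
            {in (unit_seg R) &, injective (arc u v)},
            arc u v 0 = pos u, arc u v 1 = pos v &
            forall t w, open_seg R t -> arc u v t <> pos w],
      forall u v u' v', is_edge G u v -> is_edge G u' v' -> (u, v) <> (u', v') ->
        forall t s, open_seg R t -> open_seg R s -> arc u v t <> arc u' v' s &
      (* all vertices lie on the boundary of the outer (unbounded) face *)
      let D : set (R * R) :=
        range pos `|` \bigcup_(e in [set e | is_edge G e.1 e.2])
                          (arc e.1 e.2 @` unit_seg R) in
      exists x : R * R, ~ D x /\
        let U := connected_component (~` D) x in
        (forall M : R, exists p, U p /\ M < `|p.1| + `|p.2|) /\
        (forall w, closure U (pos w))].

Arguments outerplanar_embedding R [n] G pos arc.

Definition outerplanar (R : realType) (n : nat) (G : rel 'I_n) : Prop :=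
  exists pos arc, outerplanar_embedding R G pos arc.

(* Main.v *)
Require Import Defs.
From HB Require Import structures.
From mathcomp Require Import all_boot all_order all_algebra.
From mathcomp Require Import all_classical all_reals all_analysis.
From mathcomp Require Import perm zify ring lra.
Import Order.TTheory GRing.Theory Num.Theory numFieldNormedType.Exports.
Local Open Scope ring_scope.

(** A connected graph on at least five vertices without P_4 (hence also one
    without 2K_2) is a star.  In the triangle-free case the star has Q-index
    at least n.  Conversely, if x is an eigenvector of Q(G) for r, then
    r (x_u + x_v) is the sum of the values x_a + x_b over the edges ab at u and
    at v; at an edge maximising |x_u + x_v| this gives r <= d_u + d_v <= n,
    and r = n propagates maximality along G, so that d_u + d_v = n on every
    edge.  Then G is complete bipartite, and unless it is a star it contains
    K_{2,3}.

    K_{2,3} is not outerplanar: a point of the outer face U, joined to the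
    three vertices of the larger class through U, completes the drawing to one
    of K_{3,3} in which nonadjacent edges are disjoint.  Replace edges by fine
    chains of points and let k(e, v) be the signed number of times the chain e,
    seen from the vertex v, crosses the negative horizontal axis.  For
    nonadjacent e = uw and f = vv' the differences e_i - f_j avoid 0, so their
    total crossing number around the grid of indices vanishes; this is a linear
    relation between k(e,v), k(e,v'), k(f,u), k(f,w) and the relative positions
    of the end points.  Adding the 18 relations equates an odd
    number with an even one. *)

(** * Signed axis crossings of planar chains *)

Section AxisCrossings.
Variable R : realType.
Implicit Types p q v : R * R.

(** The positive half-axis is included so that exactly one of [p] and [- p] is upper when [p] is
    nonzero. *)
Definition upper p : bool := (0 < p.2) || ((p.2 == 0) && (0 < p.1)).

Definition cross p q : R := p.1 * q.2 - p.2 * q.1.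

(* The signed number of times the step from p to q crosses the negative
   first axis, counterclockwise crossings being positive. *)
Definition axis_crossing p q : int :=
  ([&& upper p, ~~ upper q & 0 < cross p q] : nat)%:Z
  - ([&& ~~ upper p, upper q & ~~ (0 < cross p q)] : nat)%:Z.

Lemma upperN p : p != 0 -> upper (- p) = ~~ upper p.
Proof.
case: p => x y; rewrite /upper /= !oppr_gt0 oppr_eq0.
case: (ltgtP y 0) => //= ->; case: (ltgtP x 0) => //= ->.
by rewrite eqxx.
Qed.

Lemma crossN p q : cross (- p) (- q) = cross p q.
Proof. by rewrite /cross /= !mulrNN. Qed.

(** Negation trades crossings of the negative half-axis for crossings of the positive one, and the
    two counts differ only by the change of side. *)
Lemma axis_crossingN p q : p != 0 -> q != 0 ->
  axis_crossing (- p) (- q) =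
  axis_crossing p q + (upper q : nat)%:Z - (upper p : nat)%:Z.
Proof.
move=> p0 q0; rewrite /axis_crossing crossN !upperN //.
by case: (upper p); case: (upper q); case: (0 < cross p q).
Qed.

(** In the max norm, a coordinate of [a] of largest modulus keeps its sign on this open square,
    which therefore lies in an open half-plane bounded by an axis. *)
Lemma axis_crossing_potential a : a != 0 ->
  exists L : R * R -> int, forall p q, `|p - a| < `|a| -> `|q - a| < `|a| ->
    axis_crossing p q = L q - L p.
Proof.
move=> a0.
have near1 z : `|z - a| < `|a| -> `|a.2| <= `|a.1| -> 0 < a.1 * z.1.
  rewrite !prod_normE /= => + h; rewrite (max_idPl h) gt_max => /andP[+ _].
  have : a.1 != 0.
    apply: contraNneq a0 => a10; move: h; rewrite a10 normr0 normr_le0 => /eqP a20.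
    by apply/eqP; rewrite (surjective_pairing a) a10 a20.
  rewrite ltr_norml; case: (ltgtP a.1 0) => // ha _.
    by rewrite ltr0_norm // => /andP[h1 h2]; rewrite nmulr_rgt0 //; lra.
  by rewrite gtr0_norm // => /andP[h1 h2]; rewrite pmulr_rgt0 //; lra.
have near2 z : `|z - a| < `|a| -> `|a.1| < `|a.2| -> 0 < a.2 * z.2.
  rewrite !prod_normE /= => + h; rewrite (max_idPr (ltW h)) gt_max => /andP[_ +].
  rewrite ltr_norml; case: (ltgtP a.2 0) => ha.
  - by rewrite ltr0_norm // => /andP[h1 h2]; rewrite nmulr_rgt0 //; lra.
  - by rewrite gtr0_norm // => /andP[h1 h2]; rewrite pmulr_rgt0 //; lra.
  - by move: h; rewrite ha normr0 normr_lt0.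
case: (ltP `|a.1| `|a.2|) => h.
  exists (fun=> 0) => p q /near2/(_ h) hp /near2/(_ h) hq.
  have e : upper p = upper q.
    rewrite /upper; case: (ltgtP a.2 0) hp hq => [ha|ha|->]; last by rewrite mul0r ltxx.
      rewrite !nmulr_rgt0 // => hp hq.
      by rewrite (lt_gtF hp) (lt_gtF hq) (lt_eqF hp) (lt_eqF hq).
    by rewrite !pmulr_rgt0 // => -> ->.
  by rewrite /axis_crossing e; case: (upper q).
case: (ltgtP a.1 0) => ha.
(* Left of the vertical axis, changing sides means crossing the negative half-axis, so the indicator
   of the lower side is a potential. *)
- exists (fun p => (~~ upper p : nat)%:Z) => p q /near1/(_ h) + /near1/(_ h).
  rewrite !nmulr_rgt0 // => hp hq.
  have main u v : u.1 < 0 -> v.1 < 0 -> upper u -> ~~ upper v -> 0 < cross u v.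
    rewrite /upper /cross => hu hv; rewrite (lt_gtF hu) (lt_gtF hv) !andbF !orbF -leNgt.
    by move=> uu vv; nra.
  have crossC u v : cross u v = - cross v u by rewrite /cross; ring.
  rewrite /axis_crossing.
  case: (boolP (upper p)) => up; case: (boolP (upper q)) => uq //=.
    by rewrite main.
  by rewrite crossC oppr_gt0 (lt_gtF (main _ _ hq hp uq up)).
- exists (fun=> 0) => p q /near1/(_ h) + /near1/(_ h).
  rewrite !pmulr_rgt0 // => hp hq.
  have main u v : 0 < u.1 -> 0 < v.1 -> upper u -> ~~ upper v -> cross u v < 0.
    rewrite /upper /cross => hu hv; rewrite hu hv !andbT => uu vv.
    have {}uu : 0 <= u.2 by move: uu; case: (ltgtP u.2 0).
    have {}vv : v.2 < 0 by move: vv; case: (ltgtP v.2 0).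
    nra.
  have crossC u v : cross u v = - cross v u by rewrite /cross; ring.
  rewrite /axis_crossing.
  case: (boolP (upper p)) => up; case: (boolP (upper q)) => uq //=.
    by rewrite (lt_gtF (main _ _ hp hq up uq)).
  by rewrite crossC oppr_gt0 (main _ _ hq hp uq up).
- case/negP: a0; move: h; rewrite ha normr0 normr_le0 => /eqP a2.
  by apply/eqP; rewrite (surjective_pairing a) ha a2.
Qed.

(** This is the k(e, v) of the overview. Chains are open in general, so the count depends on the
    chosen half-axis. *)
Definition winding (p : nat -> R * R) (m : nat) (v : R * R) : int :=
  \sum_(i < m) axis_crossing (p i - v) (p i.+1 - v).

(** The step bound keeps the corners of each cell of the grid [p i - q j] in a square where
    crossings have a potential, so the crossings around a cell cancel. Adding the cells leaves the
    boundary of the grid. *)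
Lemma winding_grid (p q : nat -> R * R) (m l : nat) :
  (forall i j, (i <= m)%N -> (j <= l)%N -> p i != q j) ->
  (forall i j, (i < m)%N -> (j < l)%N ->
    `|p i.+1 - p i| + `|q j.+1 - q j| < `|p i - q j|) ->
  winding p m (q 0%N) - winding p m (q l) + winding q l (p m) - winding q l (p 0%N)
  + (upper (q l - p m) : nat)%:Z - (upper (q 0%N - p m) : nat)%:Z
  - (upper (q l - p 0%N) : nat)%:Z + (upper (q 0%N - p 0%N) : nat)%:Z = 0.
Proof.
move=> pq step.
pose h i j := p i - q j.
pose V i := \sum_(j < l) axis_crossing (h i j) (h i j.+1).
(* With [i] fixed the grid runs through the negatives of [q j - p i]; the [upper] terms caused by
   the sign telescope. *)
have hV i : (i <= m)%N -> V i = winding q l (p i) +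
    (upper (q l - p i) : nat)%:Z - (upper (q 0%N - p i) : nat)%:Z.
  move=> im; rewrite -addrA.
  rewrite -(telescope_sumr (fun j => (upper (q j - p i) : nat)%:Z) (leq0n l)) big_mkord.
  rewrite /V /winding -big_split; apply: eq_bigr => j _ /=.
  rewrite /h -!(opprB (q _)) axis_crossingN ?addrA // subr_eq0 eq_sym pq //.
    exact: ltnW.
(* These two identities join adjacent rectangles, first along [j], then along [i]. *)
have glue (x y z t u v w : int) :
  x + y = z + t -> t + u = v + w -> x + (y + u) = z + v + w by lia.
have glue' (x y z t u v w : int) :
  x + y = z + t -> u + v = y + w -> x + u + v = z + (t + w) by lia.
have cell i j : (i < m)%N -> (j < l)%N ->
  axis_crossing (h i j) (h i.+1 j) + axis_crossing (h i.+1 j) (h i.+1 j.+1) =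
  axis_crossing (h i j) (h i j.+1) + axis_crossing (h i j.+1) (h i.+1 j.+1).
  move=> im jl; have hij : h i j != 0 by rewrite subr_eq0 pq // ltnW.
  have [L HL] := axis_crossing_potential _ hij.
  have st := step _ _ im jl.
  have h00 : `|h i j - h i j| < `|h i j| by rewrite subrr normr0 normr_gt0.
  have h10 : `|h i.+1 j - h i j| < `|h i j|.
    apply: le_lt_trans st; rewrite /h opprB addrA subrK.
    by rewrite lerDl.
  have h01 : `|h i j.+1 - h i j| < `|h i j|.
    apply: le_lt_trans st; rewrite /h opprB addrC addrA subrK distrC.
    by rewrite lerDr.
  have h11 : `|h i.+1 j.+1 - h i j| < `|h i j|.
    apply: le_lt_trans st; rewrite /h.
    have -> : p i.+1 - q j.+1 - (p i - q j) = (p i.+1 - p i) - (q j.+1 - q j).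
      by rewrite !opprB addrACA [RHS]addrACA [- q _ + _]addrC.
    exact: ler_normB.
  by rewrite !HL //; lia.
have col i : (i < m)%N ->
  axis_crossing (h i 0%N) (h i.+1 0%N) + V i.+1 = V i + axis_crossing (h i l) (h i.+1 l).
  move=> im; rewrite /V; have : (l <= l)%N by [].
  elim: {-2}l => [|j IH] jl; first by rewrite !big_ord0 addr0 add0r.
  by rewrite !big_ord_recr /=; apply: glue (IH (ltnW jl)) (cell _ _ im jl).
have : \sum_(i < m) axis_crossing (h i 0%N) (h i.+1 0%N) + V m =
       V 0%N + \sum_(i < m) axis_crossing (h i l) (h i.+1 l).
  have : (m <= m)%N by [].
  elim: {-2}m => [|i IH] im; first by rewrite !big_ord0 addr0 add0r.
  rewrite !big_ord_recr /=; apply: glue' (IH (ltnW im)) (col _ im).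
rewrite !hV //; rewrite -!/(winding p m _); lia.
Qed.
End AxisCrossings.

(* In the sum of all 18 relations, the terms bb and the constants contribute
   9 - 18, and all other coefficients are even. *)
Lemma K33_parity (ab aa bb : nat -> nat -> int)
    (ka kb : nat -> nat -> nat -> int) :
  (forall j j', (j < 3)%N -> (j' < 3)%N -> j != j' -> bb j j' + bb j' j = 1) ->
  (forall i i' j j', (i < i' < 3)%N -> (j < 3)%N -> (j' < 3)%N -> j != j' ->
    ka i j i' - kb i j j' + kb i' j' j - ka i' j' i
    + bb j j' - (1 - ab i' j) - ab i j' + aa i i' = 0) -> False.
Proof.
move=> hbb H.
pose A i i' := ka i 0%N i' + ka i 1%N i' + ka i 2%N i'.
pose B i := kb i 0%N 1%N + kb i 1%N 0%N + kb i 0%N 2%N + kb i 2%N 0%N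
  + kb i 1%N 2%N + kb i 2%N 1%N.
pose X i := ab i 0%N + ab i 1%N + ab i 2%N.
(* For two fixed rows the six relations, one per ordered pair of columns, are added; [hbb] turns
   their [bb] terms into 3. *)
have S i i' : (i < i' < 3)%N ->
    A i i' *+ 2 - B i + B i' - A i' i *+ 2 + 3 - (3 - X i') *+ 2 - X i *+ 2
    + aa i i' *+ 6 = 0.
  move=> ii'.
  have := H i i' 0%N 1%N ii' isT isT isT; have := H i i' 1%N 0%N ii' isT isT isT.
  have := H i i' 0%N 2%N ii' isT isT isT; have := H i i' 2%N 0%N ii' isT isT isT.
  have := H i i' 1%N 2%N ii' isT isT isT; have := H i i' 2%N 1%N ii' isT isT isT.
  have := hbb 0%N 1%N isT isT isT; have := hbb 0%N 2%N isT isT isT.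
  have := hbb 1%N 2%N isT isT isT.
  rewrite /A /B /X; lra.
(* Over the three pairs of rows the [B] terms add up to twice [B 2 - B 0], so everything but the 9
   is even. *)
have := S 0%N 1%N isT; have := S 0%N 2%N isT; have := S 1%N 2%N isT.
move: A B X {S} => A B X; lia.
Qed.

(** * Fine chains in connected sets *)

Local Open Scope classical_set_scope.

(** Serves to adjoin a boundary vertex to the outer face. *)
Lemma connected_between (T : topologicalType) (A B : set T) :
  connected A -> A `<=` B -> B `<=` closure A -> connected B.
Proof.
move=> cA AB BA V [z Vz] [C oC VC] [D cD VD].
have ACV : A `&` C = A.
  apply: cA; last 2 first.
  - by exists C.
  - exists D => //; apply/seteqP; split=> w [Aw Cw]; split=> //.
      by have : V w by [rewrite VC; split=> //; apply: AB]; rewrite VD => -[].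
    by have : V w by [rewrite VD; split=> //; apply: AB]; rewrite VC => -[].
  move: Vz; rewrite VC => -[/BA clz Cz].
  by have [w Aw] := clz C (open_nbhs_nbhs (conj oC Cz)); exists w.
have AD : A `<=` D.
  move=> w Aw; have : V w by rewrite VC; split; [exact: AB|move: Aw; rewrite -ACV => -[]].
  by rewrite VD => -[].
rewrite VD; apply/seteqP; split=> [w []//|w Bw]; split=> //.
by apply: cD; apply: closureS AD _ (BA _ Bw).
Qed.

(** The points reachable from [x] form a set open and closed in [U], because short steps at any
    point are admissible in both directions. *)
Lemma connected_chain (T : topologicalType) (U : set T) (st : T -> T -> Prop) :
  connected U ->
  (forall y, U y -> \forall z \near y, U z -> st y z /\ st z y) ->
  forall x y, U x -> U y -> exists (p : nat -> T) (m : nat),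
    [/\ p 0%N = x, p m = y, (forall i, (i <= m)%N -> U (p i)) &
        forall i, (i < m)%N -> st (p i) (p i.+1)].
Proof.
move=> cU hst x y Ux Uy.
pose S := [set z | U z /\ exists (p : nat -> T) (m : nat),
  [/\ p 0%N = x, p m = z, (forall i, (i <= m)%N -> U (p i)) &
      forall i, (i < m)%N -> st (p i) (p i.+1)]].
have Sext z w : S z -> U w -> st z w -> S w.
  move=> [_ [p [m [p0 pm pU pst]]]] Uw zw; split=> //.
  exists (fun i => if (i <= m)%N then p i else w), m.+1; split=> //.
  - by rewrite ltnn.
  - by move=> i _; case: ifP => // /pU.
  - move=> i im1; have -> : (i <= m)%N = true by []; case: ifPn => im; first exact: pst.
    have -> : i = m by apply/eqP; rewrite eqn_leq -ltnS im1 leqNgt.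
    by rewrite pm.
pose W z := [set w | U w -> st z w /\ st w z]^°.
have WW z : U z -> W z z by move=> /hst.
have WE z w : W z w -> U w -> st z w /\ st w z by move=> /interior_subset.
suff SU : S = U by have : S y by [rewrite SU]; case.
apply: cU.
- exists x; split=> //; exists (fun=> x), 0%N; split=> //.
- exists (\bigcup_(z in S) W z).
    by apply: bigcup_open => z _; apply: open_interior.
  apply/seteqP; split=> [z Sz|w [Uw [z Sz Wzw]]].
    by split; [case: Sz|exists z => //; apply: WW; case: Sz].
  by apply: (Sext _ _ Sz Uw); have [] := WE _ _ Wzw Uw.
(* A reachable point of [W z] would make [z] reachable, so the open sets [W z] at unreachable points
   [z] miss [S]. *)
- exists (~` \bigcup_(z in U `\` S) W z).
    by apply: open_closedC; apply: bigcup_open => z _; apply: open_interior.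
  apply/seteqP; split=> [w Sw|w [Uw nW]].
    split; first by case: Sw.
    move=> [z [Uz nSz] Wzw]; apply: nSz; apply: (Sext _ _ Sw Uz).
    by have [] := WE _ _ Wzw (proj1 Sw).
  by apply: contrapT => nSw; apply: nW; exists w; [split|apply: WW].
Qed.

Lemma uniform_pos (R : realType) (m : nat) (P : nat -> R -> Prop) :
  (forall i r s, 0 < s -> s <= r -> P i r -> P i s) ->
  (forall i, (i < m)%N -> exists2 r, 0 < r & P i r) ->
  exists2 r, 0 < r & forall i, (i < m)%N -> P i r.
Proof.
move=> Pmono; elim: m => [|m IH] HP; first by exists 1.
have [|r r0 Hr] := IH; first by move=> i im; apply: HP; apply: ltnW.
have [s s0 Hs] := HP m (ltnSn m).
have rs0 : 0 < Num.min r s by rewrite lt_min r0.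
exists (Num.min r s) => // i; rewrite ltnS leq_eqVlt => /predU1P[->|/Hr].
  by apply: Pmono Hs => //; rewrite ge_min lexx orbT.
by apply: Pmono => //; rewrite ge_min lexx.
Qed.

(** * The planar obstruction given by K_{3,3} *)

Section ChainsAvoiding.
Variable R : realType.
Implicit Types (U E : set (R * R)).

(** Points of [U] have positive distance from [E], so short steps are admissible locally; a chain
    has finitely many steps, which makes the margin [rho] uniform. This margin later bounds the
    steps of chains inside [E]. *)
Lemma connected_chain_away U E (eta : R) : connected U -> closed E ->
  U `&` E = set0 -> 0 < eta ->
  forall x y, U x -> U y ->
  exists (p : nat -> R * R) (m : nat) (rho : R), [/\ 0 < rho, p 0%N = x, p m = y,
    (forall i, (i <= m)%N -> U (p i)) &
    forall i, (i < m)%N -> `|p i.+1 - p i| < eta /\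
      forall d, E d -> `|p i.+1 - p i| + rho <= `|p i - d|].
Proof.
move=> cU cE UE eta0 x y Ux Uy.
pose st (y z : R * R) := `|z - y| < eta /\
  exists2 rho : R, 0 < rho & forall d, E d -> `|z - y| + rho <= `|y - d|.
have hst z : U z -> \forall w \near z, U w -> st z w /\ st w z.
  move=> Uz.
  have : nbhs z (~` E).
    apply: open_nbhs_nbhs; split; first exact: closed_openC.
    by move=> Ez; have : (U `&` E) z by []; rewrite UE.
  move=> /nbhs_normP[r /= r0 rE].
  have Er d : E d -> r <= `|z - d|.
    by move=> Ed; rewrite leNgt; apply/negP => /rE; apply.
  (* The margin [r / 2] works in both directions: from [w] the distance to [E] is still at least
     3r/4, and the step is shorter than r/4. *)
  apply/nbhs_normP; exists (Num.min eta (r / 4)) => /=.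
    by rewrite lt_min eta0 divr_gt0.
  move=> w /=; rewrite lt_min => /andP[w1 w2] Uw.
  split; split; rewrite ?(distrC w z) //; exists (r / 2) => [|d /Er Ed];
    rewrite ?divr_gt0 //.
    by lra.
  have := ler_distD w z d; lra.
have [p [m [p0 pm pU pst]]] := @connected_chain _ _ _ cU hst _ _ Ux Uy.
have [||rho rho0 Hrho] := @uniform_pos R m
    (fun i rho => forall d, E d -> `|p i.+1 - p i| + rho <= `|p i - d|).
- by move=> i r s s0 sr H d /H; lra.
- by move=> i /pst[].
- by exists p, m, rho; split=> // i im; split; [case: (pst i im)|apply: Hrho].
Qed.

(* Sets sharing a vertex may meet.  The chains are chosen row by row: a row is
   fixed before the step size of the following rows, so that only those rows
   have to be closed. *)
Lemma K33_connected_sets (a b : nat -> R * R) (X : nat -> nat -> set (R * R)) :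
  (forall i j, (i < 3)%N -> (j < 3)%N ->
    [/\ connected (X i j), X i j (a i) & X i j (b j)]) ->
  (forall i j, (0 < i < 3)%N -> (j < 3)%N -> closed (X i j)) ->
  (forall i i' j j', (i < 3)%N -> (i' < 3)%N -> (j < 3)%N -> (j' < 3)%N ->
    i != i' -> j != j' -> X i j `&` X i' j' = set0) -> False.
Proof.
move=> conX cloX disX.
have disj i i' j j' z : (i < 3)%N -> (i' < 3)%N -> (j < 3)%N -> (j' < 3)%N ->
    i != i' -> j != j' -> X i j z -> X i' j' z -> False.
  by move=> *; have : (X i j `&` X i' j') z by []; rewrite disX.
(* The chain in [X i j] keeps away only from later rows, and those are closed. *)
pose E i j := \bigcup_(k in [set k : 'I_3 * 'I_3 |
  (i < k.1)%N /\ (j != k.2 :> nat)]) X k.1 k.2.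
pose row i (eta rho : R) (p : nat -> nat -> R * R) (m : nat -> nat) :=
  forall j, (j < 3)%N -> [/\ p j 0%N = a i, p j (m j) = b j,
   (forall s, (s <= m j)%N -> X i j (p j s)) &
   forall s, (s < m j)%N -> `|p j s.+1 - p j s| < eta /\
      forall d, E i j d -> `|p j s.+1 - p j s| + rho <= `|p j s - d|].
have Hrow i eta : (i < 3)%N -> 0 < eta ->
    exists p m, exists2 rho, 0 < rho & row i eta rho p m.
  move=> i3 eta0.
  have /choice[f Hf] : forall j, exists pm : (nat -> R * R) * nat, (j < 3)%N ->
    exists rho : R, [/\ 0 < rho, pm.1 0%N = a i, pm.1 pm.2 = b j,
    (forall s, (s <= pm.2)%N -> X i j (pm.1 s)) &
    forall s, (s < pm.2)%N -> `|pm.1 s.+1 - pm.1 s| < eta /\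
      forall d, E i j d -> `|pm.1 s.+1 - pm.1 s| + rho <= `|pm.1 s - d|].
    move=> j; have [j3|] := pselect (j < 3)%N; last by exists (fun=> 0, 0%N).
    have [cX Xa Xb] := conX i j i3 j3.
    have cE : closed (E i j).
      apply: closed_bigcup; first exact: finite_finset.
      move=> [k1 k2] /= [ik1 _]; apply: cloX => //.
      by rewrite ltn_ord andbT (leq_ltn_trans _ ik1).
    have XE : X i j `&` E i j = set0.
      rewrite -subset0 => z [Xz [[k1 k2] /= [ik1 jk2] Xkz]].
      by apply: (disj i k1 j k2 z) => //; rewrite neq_ltn ik1.
    have [p [m [rho Hp]]] := connected_chain_away _ _ _ cX cE XE eta0 _ _ Xa Xb.
    by exists (p, m) => _; exists rho.
  have [||rho rho0 Hrho] := @uniform_pos R 3 (fun j rho =>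
     forall s, (s < (f j).2)%N -> forall d, E i j d ->
        `|(f j).1 s.+1 - (f j).1 s| + rho <= `|(f j).1 s - d|).
  - by move=> j r s s0 sr H t /H {}H d /H; lra.
  - by move=> j /Hf[rho [rho0 _ _ _ H]]; exists rho => // s /H[].
  - exists (fun j => (f j).1), (fun j => (f j).2), rho => // j j3.
    have [rho' [_ ? ? ? H]] := Hf j j3; split=> // s sm.
    by split; [case: (H s sm)|apply: Hrho].
(* Each row takes steps shorter than the margins left by the earlier rows; the first step size 1 is
   arbitrary. *)
have [p0 [m0 [r0 r0_gt0 H0]]] := Hrow 0%N 1 isT ltr01.
have [p1 [m1 [r1 r1_gt0 H1]]] := Hrow 1%N r0 isT r0_gt0.
have r01 : 0 < Num.min r0 r1 by rewrite lt_min r0_gt0.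
have [p2 [m2 [r2 r2_gt0 H2]]] := Hrow 2%N (Num.min r0 r1) isT r01.
pose p i := nth p2 [:: p0; p1] i.
pose m i := nth m2 [:: m0; m1] i.
have Hp i i' j j' : (i < i' < 3)%N -> (j < 3)%N -> (j' < 3)%N -> j != j' ->
   forall s t, (s < m i j)%N -> (t < m i' j')%N ->
   `|p i j s.+1 - p i j s| + `|p i' j' t.+1 - p i' j' t| < `|p i j s - p i' j' t|.
  move=> ii' j3 j'3 jj' s t sm tm.
  have XE : X i' j' (p i' j' t) -> E i j (p i' j' t).
    move=> Xp; have i'3 : (i' < 3)%N by case/andP: ii'.
    by exists (Ordinal i'3, Ordinal j'3) => //=; case/andP: ii'.
  have tm' := ltnW tm.
  have lt_r (x y z w : R) : x + z <= w -> y < z -> x + y < w by lra.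
  move: ii'; rewrite andbC.
  case: i i' XE sm tm tm' => [|[|i]] [|[|[|i']]] //= XE sm tm tm' _.
  - have [_ _ X1 /(_ t tm)[lt1 _]] := H1 j' j'3.
    have [_ _ _ /(_ s sm)[_ /(_ _ (XE (X1 _ tm')))]] := H0 j j3.
    by move/lt_r; apply.
  - have [_ _ X1 /(_ t tm)[lt1 _]] := H2 j' j'3.
    have [_ _ _ /(_ s sm)[_ /(_ _ (XE (X1 _ tm')))]] := H0 j j3.
    by move/lt_r; apply; move: lt1; rewrite lt_min => /andP[].
  - have [_ _ X1 /(_ t tm)[lt1 _]] := H2 j' j'3.
    have [_ _ _ /(_ s sm)[_ /(_ _ (XE (X1 _ tm')))]] := H1 j j3.
    by move/lt_r; apply; move: lt1; rewrite lt_min => /andP[].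
have HX i j : (i < 3)%N -> (j < 3)%N -> [/\ p i j 0%N = a i, p i j (m i j) = b j &
   (forall s, (s <= m i j)%N -> X i j (p i j s))].
  case: i => [|[|[|//]]] _ j3.
  - by have [] := H0 j j3.
  - by have [] := H1 j j3.
  - by have [] := H2 j j3.
apply: (@K33_parity (fun i j => (upper R (b j - a i) : nat)%:Z)
   (fun i i' => (upper R (a i' - a i) : nat)%:Z)
   (fun j j' => (upper R (b j' - b j) : nat)%:Z)
   (fun i j i' => winding R (p i j) (m i j) (a i'))
   (fun i j j' => winding R (p i j) (m i j) (b j'))).
- move=> j j' j3 j'3 jj'; rewrite -(opprB (b j')) upperN; first by case: upper.
  rewrite subr_eq0; apply/negP => /eqP bb.
  have [_ _ X1] := conX 0%N j isT j3; have [_ _ X2] := conX 1%N j' isT j'3.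
  by apply: (disj 0%N 1%N j j' (b j)); rewrite // -bb.
- move=> i i' j j' ii' j3 j'3 jj'; have [lt_ii' i'3] := andP ii'.
  have i3 := ltn_trans lt_ii' i'3.
  have ii'_neq : i != i' by rewrite neq_ltn lt_ii'.
  have [p_0 p_m pX] := HX i j i3 j3; have [q_0 q_m qX] := HX i' j' i'3 j'3.
  have pq s t : (s <= m i j)%N -> (t <= m i' j')%N -> p i j s != p i' j' t.
    move=> /pX Xp /qX Xq; apply/eqP => e.
    by apply: (disj i i' j j' (p i j s)); rewrite // e.
  have := winding_grid R (p i j) (p i' j') (m i j) (m i' j') pq
    (Hp i i' j j' ii' j3 j'3 jj').
  (* The grid relation involves the side of [a i' - b j], the parity argument that of its negative;
     hence the term [1 - ab i' j] there. *)
  rewrite p_0 p_m q_0 q_m -(opprB (b j) (a i')) upperN; last first.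
    by have := pq _ 0%N (leqnn _) isT; rewrite p_m q_0 subr_eq0.
  by case: (upper R (b j - a i')); lia.
Qed.
End ChainsAvoiding.

(** * Outerplanar drawings and K_{2,3} *)

Section OuterplanarArcs.
Variables (R : realType) (n : nat) (G : rel 'I_n).
Variables (pos : 'I_n -> R * R) (arc : 'I_n -> 'I_n -> R -> R * R).
Hypotheses (symG : symmetric G) (irrG : irreflexive G).
Hypothesis emb : outerplanar_embedding R G pos arc.

(** An embedding constrains [arc] only at increasing pairs, so the curve is always read off
    there. *)
Definition edge_curve (x y : 'I_n) : set (R * R) :=
  if (x < y)%N then arc x y @` unit_seg R else arc y x @` unit_seg R.

Lemma edge_curveE x y : G x y -> exists u v, [/\ is_edge G u v,
  (u = x /\ v = y) \/ (u = y /\ v = x) & edge_curve x y = arc u v @` unit_seg R].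
Proof.
move=> Gxy; rewrite /edge_curve; case: ltnP => xy.
  by exists x, y; split; [rewrite /is_edge xy|left|].
exists y, x; split; [|by right|by []].
rewrite /is_edge symG Gxy andbT ltn_neqAle xy andbT.
by apply: contraTneq Gxy => /val_inj ->; rewrite irrG.
Qed.

Lemma edge_curveP x y p : G x y -> edge_curve x y p ->
  [\/ p = pos x, p = pos y | exists u v t, [/\ is_edge G u v,
     (u = x /\ v = y) \/ (u = y /\ v = x), open_seg R t & p = arc u v t]].
Proof.
move=> /edge_curveE[u [v [uv hxy ->]]] [t /= /andP[t0 t1] <-].
have [_ /(_ _ _ uv)[_ _ e0 e1 _] _ _] := emb.
have [t00|t00] := eqVneq t 0.
  by rewrite t00 e0; case: hxy => -[<- <-]; [constructor 1|constructor 2].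
have [t10|t10] := eqVneq t 1.
  by rewrite t10 e1; case: hxy => -[<- <-]; [constructor 2|constructor 1].
constructor 3; exists u, v, t; split=> //.
by rewrite /open_seg /= !lt_neqAle t0 t1 t10 eq_sym t00.
Qed.

Lemma edge_curve_ends x y : G x y -> edge_curve x y (pos x) /\ edge_curve x y (pos y).
Proof.
move=> /edge_curveE[u [v [uv hxy ->]]].
have [_ /(_ _ _ uv)[_ _ e0 e1 _] _ _] := emb.
have h0 : (arc u v @` unit_seg R) (pos u) by exists 0; rewrite // /unit_seg /= lexx ler01.
have h1 : (arc u v @` unit_seg R) (pos v) by exists 1; rewrite // /unit_seg /= lexx ler01.
by case: hxy h0 h1 => -[-> ->].
Qed.

Lemma unit_segE : unit_seg R = `[0, 1]%classic.
Proof. by apply/seteqP; split=> t; rewrite /= in_itv. Qed.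

Lemma edge_curve_connected x y : G x y -> connected (edge_curve x y).
Proof.
move=> /edge_curveE[u [v [uv hxy ->]]].
have [_ /(_ _ _ uv)[ct _ _ _ _] _ _] := emb.
apply: connected_continuous_connected ct.
by rewrite unit_segE; exact: segment_connected.
Qed.

Lemma edge_curve_closed x y : G x y -> closed (edge_curve x y).
Proof.
move=> /edge_curveE[u [v [uv hxy ->]]].
have [_ /(_ _ _ uv)[ct _ _ _ _] _ _] := emb.
apply: compact_closed; first exact: norm_hausdorff.
apply: continuous_compact ct _.
by rewrite unit_segE; exact: segment_compact.
Qed.

Lemma edge_curve_pos x y z : G x y -> edge_curve x y (pos z) -> z = x \/ z = y.
Proof.
have [injp earc _ _] := emb.
move=> Gxy /(edge_curveP _ _ _ Gxy)[/injp->|/injp->|[u [v [t [uv _ ot e]]]]];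
  [by left|by right|].
by have [_ _ _ _ h] := earc _ _ uv; case: (h t z ot).
Qed.

Lemma edge_curve_disjoint x y x' y' : G x y -> G x' y' ->
  x != x' -> x != y' -> y != x' -> y != y' -> edge_curve x y `&` edge_curve x' y' = set0.
Proof.
move=> Gxy Gxy' xx' xy' yx' yy'; rewrite -subset0 => p [].
have [injp earc disj _] := emb.
move=> hp hp'.
have := edge_curveP _ _ _ Gxy hp; case=> [e|e|[u [v [t [uv uvxy ot e]]]]].
- move: hp'; rewrite e => /(edge_curve_pos _ _ _ Gxy')[] /eqP;
    by rewrite ?(negPf xx') ?(negPf xy').
- move: hp'; rewrite e => /(edge_curve_pos _ _ _ Gxy')[] /eqP;
    by rewrite ?(negPf yx') ?(negPf yy').
have := edge_curveP _ _ _ Gxy' hp'; case=> [e'|e'|[u' [v' [t' [uv' uvxy' ot' e']]]]].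
- move: hp; rewrite e' => /(edge_curve_pos _ _ _ Gxy)[] /eqP;
    by rewrite eq_sym ?(negPf xx') ?(negPf yx').
- move: hp; rewrite e' => /(edge_curve_pos _ _ _ Gxy)[] /eqP;
    by rewrite eq_sym ?(negPf xy') ?(negPf yy').
apply: (disj u v u' v' uv uv' _ t t' ot ot'); last by rewrite -e -e'.
case=> eu ev; move: xx' xy' yx' yy'; subst u' v'.
by case: uvxy => -[<- <-]; case: uvxy' => -[<- <-]; rewrite ?eqxx.
Qed.

(** Row 0 of the K_{3,3} consists of the outer face with one vertex [pos (w j)] adjoined, which
    replaces an arc from [x] to that vertex. These sets are connected since the vertex lies in the
    closure of the face; the rows 1 and 2 are edge curves, which are compact and so closed. *)
Lemma K23_not_outerplanar (u w : nat -> 'I_n) :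
  u 1%N != u 2%N ->
  (forall j j', (j < 3)%N -> (j' < 3)%N -> j != j' -> w j != w j') ->
  (forall i j, (0 < i < 3)%N -> (j < 3)%N -> G (u i) (w j)) -> False.
Proof.
move=> u12 winj Guw.
have [injp earc disj [x [nDx [_ clU]]]] := emb.
set D := _ `|` _ in nDx clU; set U := connected_component _ _ in clU.
have UD : U `<=` ~` D by apply: connected_component_sub.
have Ux : U x by apply: connected_component_refl.
have curveD y z : G y z -> edge_curve y z `<=` D.
  move=> /edge_curveE[a [b [ab _ ->]]] p hp; right.
  by exists (a, b).
pose X i j := if i == 0%N then U `|` [set pos (w j)] else edge_curve (u i) (w j).
have uw i j : (0 < i < 3)%N -> (j < 3)%N -> u i != w j.
  by move=> i3 j3; apply: contraTneq (Guw i j i3 j3) => ->; rewrite irrG.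
have X0dis i j j' : (0 < i < 3)%N -> (j < 3)%N -> (j' < 3)%N -> j != j' ->
    (U `|` [set pos (w j)]) `&` edge_curve (u i) (w j') = set0.
  move=> i3 j3 j'3 jj'; rewrite -subset0 => p [[Up|->] hp].
    by apply: (UD _ Up); apply: curveD hp; apply: Guw.
  case: (edge_curve_pos _ _ _ (Guw i j' i3 j'3) hp) => /eqP.
    by rewrite eq_sym (negPf (uw _ _ i3 j3)).
  by rewrite (negPf (winj _ _ j3 j'3 jj')).
apply: (@K33_connected_sets R (fun i => if i == 0%N then x else pos (u i))
  (fun j => pos (w j)) X).
- move=> [|i] j i3 j3; rewrite /X /=; last first.
    have Gij := Guw i.+1 j i3 j3; have [? ?] := edge_curve_ends _ _ Gij.
    by split=> //; apply: edge_curve_connected.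
  split; [|by left|by right].
  apply: (@connected_between _ U); first exact: component_connected.
    by left.
  by move=> p [/subset_closure//|->]; apply: clU.
- by move=> [|i] j i3 j3 //; rewrite /X /=; apply: edge_curve_closed; apply: Guw.
- move=> [|i] [|i'] j j' i3 i'3 j3 j'3 // ii' jj'; rewrite /X /=.
  + exact: X0dis.
  + by rewrite setIC X0dis // eq_sym.
  + apply: edge_curve_disjoint; rewrite ?Guw ?uw ?winj //.
      by case: i i' i3 i'3 ii' => [|[|i]] [|[|i']] // _ _ _; rewrite eq_sym.
    by rewrite eq_sym uw.
Qed.
End OuterplanarArcs.

(** * An outerplanar drawing of the star *)

Section StarEmbedding.
Variables (R : realType) (n : nat).

Definition star_pos (w : 'I_n) : R * R := (w%:R, 0).

(* Below the line carrying all vertices, the arc from 0 to v is the parabola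
   y = - x (v - x); these parabolas meet only at the origin. *)
Definition star_arc (u v : 'I_n) (t : R) : R * R :=
  (t * v%:R, - (t * v%:R * (v%:R - t * v%:R))).

Lemma star_edge u v : is_edge (star_rel n) u v -> (val u = 0 /\ 0 < val v)%N.
Proof.
rewrite /is_edge /star_rel => /andP[uv /andP[_ /orP[/eqP u0|/eqP v0]]].
  by rewrite u0 -u0.
by rewrite v0 in uv.
Qed.

Lemma affine_segment_connected (p q : R * R) :
  connected ((fun t : R => (p.1 + t * (q.1 - p.1), p.2 + t * (q.2 - p.2))) @` `[0, 1]).
Proof.
apply: connected_continuous_connected; first exact: segment_connected.
apply: continuous_subspaceT => /= t.
have aff (c d : R) : (c + x * d) @[x --> t] --> c + t * d.
  by apply: cvgD; [exact: cvg_cst|apply: cvgM; [|exact: cvg_cst]; exact: cvg_id].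
exact: cvg_pair (aff p.1 (q.1 - p.1)) (aff p.2 (q.2 - p.2)).
Qed.

(** The drawing lies in the closed lower half-plane, so segments from (0, 1) put the whole open
    upper half-plane into one component of the complement. That half-plane is unbounded and has
    every vertex in its closure. *)
Lemma star_outerplanar : outerplanar R (star_rel n).
Proof.
exists star_pos, star_arc; split.
- by move=> u v [] /eqP; rewrite eqr_nat => /eqP/val_inj.
- move=> u v /star_edge[u0 v0].
  have v0' : 0 < v%:R :> R by rewrite ltr0n.
  split.
  + apply: continuous_subspaceT => /= t.
    have ctv : (x * v%:R) @[x --> t] --> t * v%:R.
      by apply: cvgM; [|exact: cvg_cst]; exact: cvg_id.
    have cy : (- (x * v%:R * (v%:R - x * v%:R))) @[x --> t] -->
        - (t * v%:R * (v%:R - t * v%:R)).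
      by apply: cvgN; apply: cvgM => //; apply: cvgB => //; exact: cvg_cst.
    exact: cvg_pair ctv cy.
  + by move=> s t _ _ [] /(mulIf (lt0r_neq0 v0')).
  + by rewrite /star_arc mul0r subr0 mul0r oppr0 /star_pos u0.
  + by rewrite /star_arc mul1r subrr mulr0 oppr0.
  + move=> t w /andP[t0 t1] [] _ /eqP.
    by rewrite oppr_eq0 gt_eqF // mulr_gt0 ?mulr_gt0 // subr_gt0 gtr_pMl.
- move=> u v u' v' /star_edge[u0 v0] /star_edge[u'0 v'0] neq t s.
  move=> /andP[t0 t1] /andP[s0 s1] [] e1.
  rewrite -e1 => /oppr_inj/mulfI e2; apply: neq.
  have v0' : 0 < v%:R :> R by rewrite ltr0n.
  have /addIr/eqP : v%:R - t * v%:R = v'%:R - t * v%:R :> R.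
    by apply: e2; rewrite mulf_neq0 ?gt_eqF.
  rewrite eqr_nat => /eqP/val_inj ->; congr (_, _).
  by apply: val_inj; rewrite u0 u'0.
- move=> D.
  have Dle p : D p -> p.2 <= 0.
    case=> [[w _ <-]//|[[u v] /= /star_edge[u0 v0] [t /andP[t0 t1] <-]] /=].
    have v0' : 0 < v%:R :> R by rewrite ltr0n.
    rewrite oppr_le0; apply: mulr_ge0; first by rewrite mulr_ge0 // ltW.
    by rewrite subr_ge0 ler_piMl // ltW.
  have H p : 0 < p.2 -> connected_component (~` D) (0, 1) p.
    move=> p0; exists ((fun t : R => (0 + t * (p.1 - 0), 1 + t * (p.2 - 1))) @` `[0, 1]).
      split; last exact: (affine_segment_connected (0, 1) p).
        by exists 0; rewrite /= ?in_itv /= ?lexx ?ler01 // !mul0r !addr0.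
      move=> z [t /=]; rewrite in_itv /= => /andP[t0 t1] <- /Dle /=; nra.
    exists 1; first by rewrite /= in_itv /= lexx ler01.
    by rewrite !mul1r add0r subr0 addrC subrK; case: p p0.
  exists (0, 1); split; first by move=> /Dle /=; rewrite ler10.
  split.
    move=> M; exists (0, `|M| + 1); split; first by apply: H; rewrite /= ltr_wpDl.
    rewrite /= normr0 add0r ger0_norm ?addr_ge0 //.
    by have := ler_norm M; lra.
  move=> w B /nbhs_normP[e /= e0 eB].
  exists (w%:R, e / 2); split; first by apply: H; rewrite /= divr_gt0.
  apply: eB; rewrite /= prod_normE /= subrr normr0 sub0r normrN.
  by rewrite gtr0_norm ?divr_gt0 // gt_max e0 /=; lra.
Qed.
End StarEmbedding.

(** * Eigenvalues of the signless Laplacian of a triangle-free graph *)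

Lemma degE (n : nat) (G : rel 'I_n) u : deg G u = #|[pred w | G u w]|.
Proof. by apply: eq_card => w; apply/idP/idP => [/set_mem|/mem_set]. Qed.

Section SignlessLaplacianSpectrum.
Variables (R : realType) (n : nat) (G : rel 'I_n).
Hypothesis symG : symmetric G.

Lemma mul_signless_laplacian (x : 'rV[R]_n) u :
  (x *m signless_laplacian R G) 0 u = \sum_(w | G u w) (x 0 u + x 0 w).
Proof.
rewrite mxE; under eq_bigr do rewrite mxE mulrDr.
rewrite big_split /= (bigD1 u) //= eqxx big1 ?addr0; last first.
  by move=> i /negPf ->; rewrite mulr0.
rewrite big_split /= sumr_const; congr (_ + _).
  by rewrite degE mulr_natr.
rewrite [RHS]big_mkcond; apply: eq_bigr => w _.
by rewrite symG; case: (G u w); rewrite ?mulr1 ?mulr0.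
Qed.

Lemma eigenvector_edge_sum (r : R) (x : 'rV[R]_n) :
  x *m signless_laplacian R G = r *: x ->
  forall u, r * x 0 u = \sum_(w | G u w) (x 0 u + x 0 w).
Proof. by move=> xQ u; rewrite -mul_signless_laplacian xQ mxE. Qed.

Hypothesis triG : forall x y z, G x y -> G y z -> G x z -> False.

(** Adjacent vertices have disjoint neighbourhoods, as a common neighbour would close a triangle. *)
Lemma triangle_free_deg_sum u v : G u v ->
  (deg G u + deg G v = #|[predU [pred w | G u w] & [pred w | G v w]]|)%N.
Proof.
move=> Guv; rewrite !degE -cardUI [X in (_ + X)%N]eq_card0 ?addn0 // => w.
by rewrite !inE; apply/negP => /andP[Guw Gvw]; apply: triG Guv Gvw Guw.
Qed.

Lemma triangle_free_deg_le u v : G u v -> (deg G u + deg G v <= n)%N.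
Proof.
move=> /triangle_free_deg_sum ->; rewrite -[X in (_ <= X)%N]card_ord.
exact: max_card.
Qed.

Lemma triangle_free_deg_eq u v : G u v -> (deg G u + deg G v = n)%N ->
  forall w, G u w || G v w.
Proof.
move=> Guv; rewrite triangle_free_deg_sum // -[RHS]card_ord => e w.
have := @subset_cardP _ _ predT e; rewrite subset_predT => /(_ isT)/(_ w).
by rewrite !inE.
Qed.

(** If every edge sum vanished, the eigenvalue equation would give [r *: x = 0]; so the maximum over
    the finitely many edges is positive. *)
Lemma eigenvalue_max_edge (r : R) (x : 'rV[R]_n) : r != 0 -> x != 0 ->
  x *m signless_laplacian R G = r *: x ->
  exists u v, [/\ G u v, 0 < `|x 0 u + x 0 v| &
    forall u' v', G u' v' -> `|x 0 u' + x 0 v'| <= `|x 0 u + x 0 v|].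
Proof.
move=> r0 x0 xQ.
pose y (e : 'I_n * 'I_n) := `|x 0 e.1 + x 0 e.2|.
have [u [v [Guv yuv]]] : exists u v, G u v /\ x 0 u + x 0 v != 0.
  apply: contrapT => H; case/negP: x0; apply/eqP/rowP => u; rewrite mxE.
  apply: (mulfI r0); rewrite (eigenvector_edge_sum _ _ xQ) mulr0 big1 // => w Guw.
  by apply/eqP/negPn/negP => ne; apply: H; exists u, w.
have : exists e, G e.1 e.2 && [forall e', G e'.1 e'.2 ==> (y e' <= y e)].
  have := @arg_maxP _ R _ (u, v) [pred e | G e.1 e.2] y Guv.
  case=> e /= Ge He; exists e; rewrite Ge /=; apply/forallP => e'.
  by apply/implyP => /He.
case=> -[a b] /= /andP[Gab /forallP H]; exists a, b.
have H' u' v' : G u' v' -> `|x 0 u' + x 0 v'| <= `|x 0 a + x 0 b|.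
  by move=> Ge; have /implyP/(_ Ge) := H (u', v').
by split=> //; apply: lt_le_trans (H' _ _ Guv); rewrite normr_gt0.
Qed.

(** The equations at [u] and [v] are added and estimated by the triangle inequality. Stated with
    defects, which are nonnegative for maximal [M], the estimate yields both the bound on [r] and
    the equality case. *)
Lemma eigenvector_edge_gap (r M : R) (x : 'rV[R]_n) u v :
  x *m signless_laplacian R G = r *: x -> `|x 0 u + x 0 v| = M ->
  \sum_(w | G u w) (M - `|x 0 u + x 0 w|) + \sum_(w | G v w) (M - `|x 0 v + x 0 w|)
  <= ((deg G u + deg G v)%:R - r) * M.
Proof.
move=> xQ yM.
have sumM z : \sum_(w | G z w) M = (deg G z)%:R * M.
  by rewrite sumr_const degE mulr_natl.
have : r * M <= \sum_(w | G u w) `|x 0 u + x 0 w| + \sum_(w | G v w) `|x 0 v + x 0 w|.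
  have [r0|r0] := ltP r 0.
    apply: (@le_trans _ _ 0); last by rewrite addr_ge0 ?sumr_ge0.
    by rewrite -yM mulr_le0_ge0 // ltW.
  rewrite -yM -{1}(ger0_norm r0) -normrM mulrDr !(eigenvector_edge_sum _ _ xQ).
  by apply: le_trans (ler_normD _ _) _; apply: lerD; apply: ler_norm_sum.
by rewrite !sumrB !sumM natrD; lra.
Qed.

Lemma triangle_free_eigenvalue_le (r : R) :
  eigenvalue (signless_laplacian R G) r -> r <= n%:R.
Proof.
move=> /eigenvalueP[x xQ x0].
have [r0|r0] := leP r 0; first by rewrite (le_trans r0).
have [u [v [Guv M0 Mmax]]] := eigenvalue_max_edge _ _ (lt0r_neq0 r0) x0 xQ.
have := eigenvector_edge_gap _ _ _ _ _ xQ (erefl `|x 0 u + x 0 v|).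
move=> /(le_trans _) H.
have /H : 0 <= \sum_(w | G u w) (`|x 0 u + x 0 v| - `|x 0 u + x 0 w|)
    + \sum_(w | G v w) (`|x 0 u + x 0 v| - `|x 0 v + x 0 w|).
  by apply: addr_ge0; apply: sumr_ge0 => w Gw; rewrite subr_ge0 Mmax.
rewrite pmulr_lge0 // subr_ge0 => /le_trans; apply.
by rewrite ler_nat triangle_free_deg_le.
Qed.

(** At a maximal edge the defects are nonnegative and add up to at most [(d_u + d_v - n) M], which
    is at most 0. So the degree sum is [n] and all edges at its ends are maximal too. *)
Lemma eigenvalue_n_edge_deg : graph_connected G ->
  eigenvalue (signless_laplacian R G) n%:R ->
  forall u v, G u v -> (deg G u + deg G v = n)%N.
Proof.
move=> conG /eigenvalueP[x xQ x0].
have n0 : n%:R != 0 :> R.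
  rewrite pnatr_eq0; apply: contraNneq x0 => n0; apply/eqP/rowP => i.
  by have := ltn_ord i; rewrite [X in (_ < X)%N]n0.
have [a [b [Gab M0 Mmax]]] := eigenvalue_max_edge _ _ n0 x0 xQ.
set M := `|x 0 a + x 0 b| in M0 Mmax.
have spread u v : G u v -> `|x 0 u + x 0 v| = M ->
    (deg G u + deg G v = n)%N /\ forall w, G u w -> `|x 0 u + x 0 w| = M.
  move=> Guv yM; have := eigenvector_edge_gap _ _ _ _ _ xQ yM.
  set Su := \sum_(w | G u w) _; set Sv := \sum_(w | G v w) _ => gap.
  have Su0 : 0 <= Su by apply: sumr_ge0 => w Gw; rewrite subr_ge0 Mmax.
  have Sv0 : 0 <= Sv by apply: sumr_ge0 => w Gw; rewrite subr_ge0 Mmax.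
  have dle := triangle_free_deg_le _ _ Guv.
  have dge : (n <= deg G u + deg G v)%N.
    rewrite -(ler_nat R) -subr_ge0 -(pmulr_lge0 _ M0).
    by apply: le_trans gap; apply: addr_ge0.
  have d : (deg G u + deg G v = n)%N by apply/eqP; rewrite eqn_leq dle.
  split=> // w Guw; move: gap; rewrite d subrr mul0r => gap.
  have /eqP : Su = 0 by lra.
  rewrite psumr_eq0 => [/allP/(_ w)|z Gz]; last by rewrite subr_ge0 Mmax.
  by rewrite mem_index_enum Guw => /(_ isT) /= /eqP; lra.
(* The vertices all of whose edges are maximal form a set closed under adjacency, hence everything
   by connectedness. *)
pose S := [pred u | [forall w, G u w ==> (`|x 0 u + x 0 w| == M)]].
have Sa : a \in S.
  have [_ H] := spread _ _ Gab erefl.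
  by rewrite inE; apply/forallP => w; apply/implyP => /H ->.
have Sstep u v : G u v -> u \in S -> v \in S.
  move=> Guv; rewrite !inE => /forallP/(_ v); rewrite Guv => /eqP yM.
  have Gvu : G v u by rewrite symG.
  rewrite addrC in yM; have [_ H] := spread _ _ Gvu yM.
  by apply/forallP => w; apply/implyP => /H ->.
have Sclosed : fingraph.closed G S.
  by move=> u v Guv; apply/idP/idP; apply: Sstep => //; rewrite symG.
move=> u v Guv.
have : u \in S by rewrite -(closed_connect Sclosed (conG a u)).
by rewrite inE => /forallP/(_ v); rewrite Guv => /eqP /(spread _ _ Guv)[].
Qed.

(** The supremum is attained: otherwise the characteristic polynomial would be nonzero near [n],
    although eigenvalues come arbitrarily close to it. *)
Lemma eigenvalue_of_Qindex_ge : (0 < n)%N -> n%:R <= Qindex R G ->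
  eigenvalue (signless_laplacian R G) n%:R.
Proof.
move=> n0; rewrite /Qindex; set S := mkset _ => nS.
have ubS : ubound S n%:R by move=> r /triangle_free_eigenvalue_le.
(* The supremum of the empty set is 0 by convention, which is less than [n]. *)
have S0 : S !=set0.
  apply/set0P/negP => /eqP S0; move: nS; rewrite S0 sup0 lern0.
  by rewrite eqn0Ngt n0.
have supS : has_sup S by split=> //; exists n%:R.
have supE : sup S = n%:R by apply/eqP; rewrite eq_le nS ge_sup.
rewrite eigenvalue_root_char; apply/negPn/negP => nroot.
have : \forall z \near (n%:R : R), (char_poly (signless_laplacian R G)).[z] != 0.
  apply: (@continuous_horner R (char_poly (signless_laplacian R G)) n%:R [set z | z != 0]).
  by apply: open_nbhs_nbhs; split=> //; exact: open_neq.
move=> /nbhs_normP[e /= e0 He].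
have [z Sz ez] := sup_adherent e0 supS.
have ze : `|n%:R - z| < e.
  rewrite ger0_norm; last by rewrite subr_ge0 ubS.
  by move: ez; rewrite supE; lra.
apply/negP: (He z ze); rewrite negbK.
by move: Sz; rewrite /S /= eigenvalue_root_char.
Qed.

End SignlessLaplacianSpectrum.

(** * The star as a competitor *)

Lemma star_simple (n : nat) : simple_graph (star_rel n).
Proof.
split=> [i j|i]; last by rewrite /star_rel eqxx.
by rewrite /star_rel eq_sym orbC.
Qed.

Lemma star_connected (n : nat) : graph_connected (star_rel n).
Proof.
case: n => [|n] x y; first by case: x.
have to0 (z : 'I_n.+1) : connect (star_rel n.+1) z ord0.
  have [->|z0] := eqVneq z ord0; first exact: connect0.
  by apply: connect1; rewrite /star_rel z0 orbT.
have [symS _] := star_simple n.+1.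
apply: connect_trans (to0 x) _.
by rewrite (sym_connect_sym symS) to0.
Qed.

Lemma star_triangle_free (n : nat) (x y z : 'I_n) :
  star_rel n x y -> star_rel n y z -> star_rel n x z -> False.
Proof.
rewrite /star_rel -!val_eqE /=; lia.
Qed.

Lemma C3_freeP (n : nat) (G : rel 'I_n) : simple_graph G ->
  F_free FC3 G <-> (forall x y z, G x y -> G y z -> G x z -> False).
Proof.
move=> [symG irrG]; split=> [free x y z Gxy Gyz Gxz|tri [f [_ Gf]]]; last first.
  by apply: (tri (f 0) (f 1) (f 2)); exact: Gf.
have ne a b : G a b -> a != b by move=> Gab; apply: contraTneq Gab => ->; rewrite irrG.
apply: free; exists (tnth [tuple x; y; z]); split.
  by apply/tuple_uniqP; rewrite /= !inE negb_or !ne.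
by case=> [[|[|[|//]]] i3] [[|[|[|//]]] j3] // _; rewrite !(tnth_nth x) //= symG.
Qed.

Lemma star_Qindex_ge (R : realType) (n : nat) :
  (1 < n)%N -> n%:R <= Qindex R (star_rel n).
Proof.
case: n => [|[|n]] // _.
have [symS irrS] := star_simple n.+2.
apply: ub_le_sup.
  exists n.+2%:R => r /=.
  exact: triangle_free_eigenvalue_le symS (@star_triangle_free _) _.
(* With the order minus one at the centre and 1 at the leaves, every edge sum equals the order. *)
apply/eigenvalueP; exists (\row_j (if j == ord0 then n.+1%:R else 1)); last first.
  by apply/eqP => /rowP/(_ ord0); rewrite !mxE /= => /eqP; rewrite pnatr_eq0.
apply/rowP => j; rewrite mul_signless_laplacian // !mxE.
have [->|j0] := eqVneq j ord0.
  rewrite (eq_bigr (fun=> n.+2%:R)); last first.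
    move=> w /andP[w0 _]; rewrite !mxE eq_sym (negPf w0).
    by rewrite natr1.
  rewrite sumr_const mulr_natr; congr (_ *+ _).
  transitivity #|predC1 (ord0 : 'I_n.+2)|; last by rewrite cardC1 card_ord.
  by apply: eq_card => w; rewrite unfold_in /star_rel /= andbT inE eq_sym.
rewrite (big_pred1 ord0) => [|w].
  by rewrite !mxE mulr1 -(natr1 n.+1) addrC.
rewrite /star_rel -val_eqE /=; move: j0; rewrite -!val_eqE /=; lia.
Qed.

Lemma star_isomorphic (n : nat) (G : rel 'I_n) (c : 'I_n) :
  (forall i j, G i j = (i != j) && ((i == c) || (j == c))) ->
  isomorphic G (star_rel n).
Proof.
case: n G c => [|n] G c; first by case: c.
move=> Gc; exists (tperm c ord0); split; first by exists (tperm c ord0); apply: tpermK.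
move=> i j; rewrite Gc /star_rel (inj_eq perm_inj).
have e k : (val (tperm c ord0 k) == 0%N) = (k == c).
  rewrite -(inj_eq (@perm_inj _ (tperm c ord0)) k c) tpermL.
  by rewrite -val_eqE.
by rewrite !e.
Qed.

(** * Recognising stars among connected graphs *)

Lemma connected_cut (n : nat) (G : rel 'I_n) (S : pred 'I_n) a b :
  symmetric G -> graph_connected G -> S a -> ~~ S b ->
  exists x y, [/\ G x y, S x & ~~ S y].
Proof.
move=> symG conG Sa Sb; apply: contrapT => H.
have cS : fingraph.closed G S.
  have st x y : G x y -> S x -> S y.
    by move=> Gxy Sx; apply/negPn/negP => Sy; apply: H; exists x, y.
  by move=> x y Gxy; apply/idP/idP; apply: st; rewrite // symG.
have := closed_connect cS (conG a b); rewrite !unfold_in Sa => e.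
by rewrite -e in Sb.
Qed.

Section CombinatorialStars.
Variables (n : nat) (G : rel 'I_n).
Hypotheses (n5 : (5 <= n)%N) (symG : symmetric G) (irrG : irreflexive G).
Hypothesis conG : graph_connected G.

Lemma edge_neq a b : G a b -> a != b.
Proof. by move=> Gab; apply: contraTneq Gab => ->; rewrite irrG. Qed.

Lemma fresh_vertex (s : seq 'I_n) : (size s < 5)%N -> exists w, w \notin s.
Proof.
move=> s5; apply/existsP; rewrite -negb_forall; apply/negP => /forallP H.
have : (#|'I_n| <= size s)%N.
  apply: leq_trans (card_size s); apply: subset_leq_card.
  by apply/fintype.subsetP => x _; apply: H.
by rewrite card_ord; lia.
Qed.

(** Connectedness gives a vertex [c] with two neighbours. An edge leaving its closed neighbourhood,
    or one joining two of its neighbours, would extend to a P_4 through [c]. *)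
Lemma P4_free_star : F_free FP4 G -> isomorphic G (star_rel n).
Proof.
move=> free.
have noP4 a b c d : G a b -> G b c -> G c d -> a != c -> a != d -> b != d -> False.
  move=> Gab Gbc Gcd ac ad bd; apply: free; exists (tnth [tuple a; b; c; d]); split.
    apply/tuple_uniqP; rewrite /= !inE !negb_or ac ad bd.
    by rewrite !edge_neq.
  case=> [[|[|[|[|//]]]] i3] [[|[|[|[|//]]]] j3] // _;
    by rewrite !(tnth_nth a) //= symG.
have [c [z1 [z2 [Gcz1 Gcz2 z12]]]] : exists c z1 z2, [/\ G c z1, G c z2 & z1 != z2].
  have [a _] := fresh_vertex [::] isT.
  have [a' ] := fresh_vertex [:: a] isT; rewrite inE => a'a.
  have [x [b [Gab /eqP xa ab]]] :=
    connected_cut _ _ (pred1 a) a a' symG conG (eqxx _) a'a.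
  rewrite {x}xa in Gab.
  have [w ] := fresh_vertex [:: a; b] isT; rewrite !inE => wab.
  have ha : pred2 a b a by rewrite /= eqxx.
  have [y [w' [Gyw' /orP[/eqP ya|/eqP yb] w'ab]]] :=
    connected_cut _ _ (pred2 a b) a w symG conG ha wab.
    rewrite {y}ya in Gyw'.
    by exists a, b, w'; split=> //; move: w'ab; rewrite negb_or => /andP[_]; rewrite eq_sym.
  rewrite {y}yb in Gyw'.
  by exists b, a, w'; split=> //; [rewrite symG|move: w'ab; rewrite negb_or eq_sym => /andP[]].
have cz z : z != c -> G c z.
  move=> zc; apply/negPn/negP => nGcz.
  pose S := [pred x | (x == c) || G c x].
  have Sc : S c by rewrite /= eqxx.
  have nSz : ~~ S z by rewrite /= negb_or zc.
  have [z' [w [Gzw /orP[/eqP z'c|Gcz'] /norP[wc nGcw]]]] :=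
    connected_cut _ _ S c z symG conG Sc nSz.
    by rewrite z'c (negPf nGcw) in Gzw.
  have far y : G c y -> y != z' -> False.
    move=> Gcy yz'; have yw : y != w by apply: contraNneq nGcw => <-.
    by apply: (noP4 y c z' w) => //; [rewrite symG|rewrite eq_sym].
  (* One of [z1], [z2] differs from [z'] and starts the path through [c], [z'], [w]. *)
  have [e|e] := eqVneq z1 z'; last exact: far Gcz1 e.
  by apply: far Gcz2 _; rewrite -e eq_sym.
apply: (star_isomorphic _ _ c) => i j.
have [->|ij] := eqVneq i j; first by rewrite irrG.
have [ic|ic] /= := eqVneq i c; first by rewrite ic cz // -ic eq_sym.
have [jc|jc] /= := eqVneq j c; first by rewrite jc symG cz.
apply/negP => Gij; have [w] := fresh_vertex [:: c; i; j] isT.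
rewrite !inE !negb_or => /and3P[wc wi wj].
by apply: (noP4 w c i j); rewrite // ?(symG w) ?cz // eq_sym.
Qed.

(** The only neighbour of [u] is [v], so covering makes [v] adjacent to all other vertices, and any
    further edge would close a triangle. *)
Lemma nbhs_cover_star u v : (forall x y z, G x y -> G y z -> G x z -> False) ->
  G u v -> (forall w, G u w || G v w) -> (deg G u <= 1)%N -> isomorphic G (star_rel n).
Proof.
move=> tri Guv cov d1; apply: (star_isomorphic _ _ v).
have uv w : G u w -> w = v.
  by move=> Guw; move: d1; rewrite degE => /card_le1_eqP; apply; rewrite inE.
have vz z : z != v -> G v z.
  by move=> zv; have /orP[/uv e|//] := cov z; rewrite e eqxx in zv.
move=> i j; have [->|ij] := eqVneq i j; first by rewrite irrG.
have [iv|iv] /= := eqVneq i v; first by rewrite iv vz // -iv eq_sym.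
have [jv|jv] /= := eqVneq j v; first by rewrite jv symG vz.
by apply/negP => Gij; apply: (tri v i j); rewrite ?vz.
Qed.
End CombinatorialStars.

(** A neighbour [a] of [u] and a neighbour [c] of [v] are adjacent: the edge [au] covers [c], and
    [uc] would close a triangle with [v]. Two such [a] and three such [c] form a K_{2,3}. *)
Lemma outerplanar_nbhs_small (R : realType) (n : nat) (G : rel 'I_n) u v : 
  simple_graph G -> outerplanar R G -> (forall x y z, G x y -> G y z -> G x z -> False) ->
  G u v -> (forall x y, G x y -> forall w, G x w || G y w) ->
  (1 < deg G u)%N -> (2 < deg G v)%N -> False.
Proof.
move=> [symG irrG] [pos [arc emb]] tri Guv cov.
rewrite !degE => /card_gt1P[a1 [a2 []]]; rewrite !inE => Ga1 Ga2 a12.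
move=> /card_gt2P[c0 [c1 [c2 [[]]]]]; rewrite !inE => Gc0 Gc1 Gc2 [c01 c12 c20].
have Gac a c : G u a -> G v c -> G a c.
  move=> Gua Gvc; have Gau : G a u by rewrite symG.
  have /orP[//|Guc] := cov _ _ Gau c.
  by case: (tri u v c).
(* The two vertices occupy the indices 1 and 2, index 0 being reserved for the outer face. *)
apply: (@K23_not_outerplanar R n G pos arc symG irrG emb
  (nth a1 [:: a1; a1; a2]) (nth c0 [:: c0; c1; c2])) => //.
  by move=> [|[|[|j]]] [|[|[|j']]] //=; rewrite // eq_sym.
by move=> [|[|[|i]]] [|[|[|j]]] //= _ _; apply: Gac.
Qed.

Theorem theorem3p1 (R : realType) (n : nat) (F : forbidden) (G : rel 'I_n) :
  (5 <= n)%N ->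
  simple_graph G -> graph_connected G -> outerplanar R G -> F_free F G ->
  (forall H : rel 'I_n,
     simple_graph H -> graph_connected H -> outerplanar R H -> F_free F H ->
     Qindex R H <= Qindex R G) ->
  isomorphic G (star_rel n).
Proof.
move=> n5 simG conG outG freeG maxG; have [symG irrG] := simG.
case: F freeG maxG => freeG maxG.
- exact: P4_free_star.
(* The two end edges of a P_4 form a 2K_2 on the same four vertices. *)
- apply: P4_free_star => // -[f [injf Gf]]; apply: freeG; exists f; split=> // i j ij.
  by apply: Gf; case: i j ij => [[|[|[|[|//]]]] ?] [[|[|[|[|//]]]] ?].
have tri := (C3_freeP _ _ simG).1 freeG.
have starS := star_simple n.
have Gn : n%:R <= Qindex R G.
  apply: le_trans (star_Qindex_ge R n _) _; first by lia.
  apply: maxG => //; [exact: star_connected|exact: star_outerplanar|].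
  by apply/(C3_freeP _ _ starS); apply: star_triangle_free.
have degn : forall u v, G u v -> (deg G u + deg G v = n)%N.
  have n0 : (0 < n)%N by lia.
  by apply: (eigenvalue_n_edge_deg R) => //; apply: eigenvalue_of_Qindex_ge.
have cov u v : G u v -> forall w, G u w || G v w.
  by move=> Guv; apply: triangle_free_deg_eq tri _ _ Guv (degn u v Guv).
have [a _] := fresh_vertex _ n5 [::] isT.
have [b ] := fresh_vertex _ n5 [:: a] isT; rewrite inE => ba.
have [u [v [Guv _ _]]] := connected_cut _ _ (pred1 a) a b symG conG (eqxx a) ba.
have Gvu : G v u by rewrite symG.
have [du|du] := leqP (deg G u) 1.
  exact: nbhs_cover_star tri Guv (cov _ _ Guv) du.
have [dv|dv] := leqP (deg G v) 1.
  exact: nbhs_cover_star tri Gvu (cov _ _ Gvu) dv.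
(* Both degrees are at least 2 and add up to [n], which is at least 5, so one of them exceeds 2. *)
have := degn u v Guv; case: (ltnP 2 (deg G v)) => dv2 dn.
  by case: (outerplanar_nbhs_small _ _ _ _ _ simG outG tri Guv cov du dv2).
have du2 : (2 < deg G u)%N by lia.
by case: (outerplanar_nbhs_small _ _ _ _ _ simG outG tri Gvu cov dv du2).
Qed.
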